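(* Let $\mathbb{F}=\mathbb{R}$ or $\mathbb{C}$, let $A\in\mathbb{F}^{n\times n}$ be Hermitian and invertible, let $\mathcal{S}$ be a $p$-dimensional linear subspace of $\mathbb{F}^n$ with $1\le p\le n$, let $\omega_{\min}:=-\lambda_{\min}(A)$, and suppose $q:=\mathrm{Ind}_A(\mathcal{S})\ge1$. Choose $V\in\mathbb{F}^{n\times p}$, $V'\in\mathbb{F}^{n\times q}$ such that $\begin{bmatrix}V&V'\end{bmatrix}$ has orthonormal columns, $\operatorname{Im}(V)=\mathcal{S}$ and $\operatorname{Im}(\begin{bmatrix}V&V'\end{bmatrix})=\mathcal{S}+A\mathcal{S}$, and put $T=V^*AV\in\mathbb{F}^{p\times p}$ and $B=V'^*AV\in\mathbb{F}^{q\times p}$. For $b\in\mathbb{F}^n$ and $\omega>\omega_{\min}$ let $x_{b,\omega}:=\operatorname*{arg\,min}_{x\in\mathcal{S}}\|(A+\omega I)^{-1/2}(b-Ax)\|_2$, and let $\mathcal{X}:=\operatorname{span}\{x_{b,\omega}-x_{b,\mu}: b\in\mathbb{F}^n,\ \omega,\mu>\omega_{\min}\}$. Then $\dim(\mathcal{X})=\mathrm{Ind}_A(\mathcal{S})$ if any of the following conditions holds: (i) $\operatorname{Im}(T)\cap\operatorname{Im}(B^* )=\{0\}$; (ii) $T$ is invertible.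
   Context: $\mathrm{Ind}_A(\mathcal{S}):=\dim(\mathcal{S}+A\mathcal{S})-\dim(\mathcal{S})$. $\lambda_{\min}(A)$ is the smallest eigenvalue of $A$. For $\omega>\omega_{\min}$, $A+\omega I$ is Hermitian positive definite, its power $-1/2$ is defined via the spectral decomposition, and the minimizer $x_{b,\omega}$ exists and is unique. $\operatorname{Im}$ denotes the column space. *)

(* Defs.v *)
From mathcomp Require Import all_boot all_order all_algebra.
From mathcomp Require Import complex.
From mathcomp Require Import boolp classical_sets reals.

Set Implicit Arguments.
Unset Strict Implicit.
Unset Printing Implicit Defensive.

Import Order.TTheory GRing.Theory Num.Theory.

Local Open Scope ring_scope.
Local Open Scope classical_set_scope.
Local Open Scope sesquilinear_scope.

Inductive scalar_kind := RealScalars | ComplexScalars.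

Section Scalars.
Variable R : realType.

Definition scalars (k : scalar_kind) : numFieldType :=
  match k with RealScalars => R | ComplexScalars => R[i] end.

Definition conjF (k : scalar_kind) : {rmorphism scalars k -> scalars k} :=
  match k return {rmorphism scalars k -> scalars k} with
  | RealScalars => (idfun : {rmorphism R -> R})
  | ComplexScalars => (Num.conj : {rmorphism R[i] -> R[i]})
  end.

Definition ofR (k : scalar_kind) : {rmorphism R -> scalars k} :=
  match k return {rmorphism R -> scalars k} with
  | RealScalars => (idfun : {rmorphism R -> R})
  | ComplexScalars => (real_complex R : {rmorphism R -> R[i]})
  end.

(* The library's norm on R[i] takes its (real) values in R[i]. *)
Definition modulus (k : scalar_kind) : scalars k -> R :=
  match k return scalars k -> R with
  | RealScalars => fun z : R => `|z|
  | ComplexScalars => fun z : R[i] => complex.Re `|z|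
  end.

End Scalars.

Section SetSpan.
Variables (F : fieldType) (vT : vectType F).

(* vector.v only has the span of a finite sequence. *)
Definition setspan (G : set vT) : {vspace vT} :=
  xget 0%VS [set U : {vspace vT} |
    (forall x, G x -> x \in U) /\
    (forall W : {vspace vT}, (forall x, G x -> x \in W) -> (U <= W)%VS)].

Lemma setspanP (G : set vT) :
  (forall x, G x -> x \in setspan G) /\
  (forall W : {vspace vT}, (forall x, G x -> x \in W) -> (setspan G <= W)%VS).
Proof.
pose P d := `[< exists2 U : {vspace vT}, (forall x, G x -> x \in U) & \dim U = d >].
have exP : exists d, P d.
  by exists (\dim {:vT}); apply/asboolP; exists fullv => // x _; rewrite memvf.
rewrite /setspan; set Q := [set U | _].
apply: (@xgetPex _ 0%VS Q).
case: (ex_minnP exP) => d /asboolP[U GU dU] dmin.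
exists U; split=> // W GW; apply/capv_idPl/eqP.
rewrite eqEdim capvSl /= dU; apply: dmin; apply/asboolP.
by exists (U :&: W)%VS => // x Gx; rewrite memv_cap GU ?GW.
Qed.

End SetSpan.

Section Matrices.
Variables (R : realType) (k : scalar_kind).
Local Notation F := (scalars R k).

Definition ctrmx m n (M : 'M[F]_(m, n)) : 'M[F]_(n, m) := M ^t (conjF R k).

Definition colspace m n (M : 'M[F]_(m, n)) : {vspace 'cV[F]_m} :=
  limg (linfun (mulmx M : 'cV[F]_n -> 'cV[F]_m)).

Definition norm2 n (x : 'cV[F]_n) : R :=
  Num.sqrt (\sum_(i < n) modulus (x i 0) ^+ 2).

Section Square.
Variable n : nat.
Implicit Types (A M : 'M[F]_n) (S : {vspace 'cV[F]_n}) (b x : 'cV[F]_n).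

Definition lambda_min A : R :=
  xget 0 [set l : R | eigenvalue A (ofR R k l) /\
                      forall m : F, eigenvalue A m -> ofR R k l <= m].

(* M^(-1/2) for M Hermitian positive definite: if M = U diag(d) U^* with U
   unitary and d > 0, then M^(-1/2) = U diag(d^(-1/2)) U^*, which does not
   depend on the choice of U and d. *)
Definition invsqrtmx M : 'M[F]_n :=
  xget 0 [set N | exists (U : 'M[F]_n) (d : 'rV[R]_n),
    [/\ ctrmx U *m U = 1%:M,
        forall i, 0 < d 0 i,
        M = U *m diag_mx (map_mx (ofR R k) d) *m ctrmx U &
        N = U *m diag_mx (map_mx (fun t => ofR R k (Num.sqrt t)^-1) d)
              *m ctrmx U]].

Definition imspace A S : {vspace 'cV[F]_n} :=
  (linfun (mulmx A : 'cV[F]_n -> 'cV[F]_n) @: S)%VS.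

(* The truncated subtraction is exact, since S is included in S + A S. *)
Definition Ind A S : nat := (\dim (S + imspace A S)%VS - \dim S)%N.

Definition argmin_sol A S b (omega : R) : 'cV[F]_n :=
  let W := invsqrtmx (A + (ofR R k omega)%:M) in
  xget 0 [set x | x \in S /\
    forall y, y \in S -> norm2 (W *m (b - A *m x)) <= norm2 (W *m (b - A *m y))].

Definition diffspace A S : {vspace 'cV[F]_n} :=
  setspan [set z | exists b (omega mu : R),
    [/\ - lambda_min A < omega, - lambda_min A < mu &
        z = argmin_sol A S b omega - argmin_sol A S b mu]].

End Square.
End Matrices.

(* Main.v *)
(* Write M = A + omega I and P = {s | V^* A s = 0}. Since A is Hermitian, x in S
   is the minimizer for b iff M^-1 (b - A x) lies in P, i.e. iff
   b = A x + (A + omega I) s for some s in P. Moreover A V = V T + V' B, so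
   s in P means T V^* s = - B^* V'^* s.
   - If b = A V y1 + (A + omega I) s1 = A V y2 + (A + mu I) s2 with s1, s2 in P,
     applying V^* gives T (y1 - y2) = V^* (mu s2 - omega s1), whence
     T^2 (y1 - y2) is in Im B^*.
   - Conversely, if T^2 y = B^* w, then s' = - A^-1 V' (w + B y) and
     t = A V y + (A + omega I) s' are in P. For mu = omega + 1 and
     b = (A + mu I) t = A V y + (A + omega I) (t + s'), the minimizers are
     0 for mu and V y for omega.
   Hence the space of differences is V {y | T^2 y in Im B^*}. As B^* is injective
   and [T^2, B^*] is onto (T^2 y = 0 forces T y = 0 because T is Hermitian, and
   T y = B y = 0 forces A V y = 0), its dimension is (p + q) - p = q. *)

Require Import Defs.
From mathcomp Require Import all_boot all_order all_algebra.
From mathcomp Require Import complex.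
From mathcomp Require Import boolp classical_sets reals.

Import Order.TTheory GRing.Theory Num.Theory.

Local Open Scope ring_scope.

Set Implicit Arguments.
Unset Strict Implicit.
Unset Printing Implicit Defensive.

(** * Scalars: conjugation, modulus and embedded reals, treated uniformly over both fields *)

Section ScalarTheory.
Variables (R : realType) (k : scalar_kind).
Local Notation F := (scalars R k).
Local Notation conj := (conjF R k).
Local Notation ofR := (ofR R k).
Implicit Types (z : F) (r : R).

Lemma conjFK : involutive conj.
Proof. by case: k => z /=; rewrite ?conjCK. Qed.

Lemma mulF_conj z : z * conj z = ofR (modulus z ^+ 2).
Proof.
move: z; case: k => /= z; first by rewrite -expr2 real_normK ?num_real.
by rewrite -normCK normc_def rmorphXn; case: z.
Qed.

Lemma conjF_ofR r : conj (ofR r) = ofR r.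
Proof. by case: k => //=; rewrite conj_Creal // complex_real. Qed.

Lemma conjF_real z : conj z = z -> exists r, z = ofR r.
Proof.
move: z; case: k => /= z; first by exists z.
by move/CrealP/complex_realP.
Qed.

Lemma ler_ofR r1 r2 : (ofR r1 <= ofR r2) = (r1 <= r2).
Proof. by case: k => //=; rewrite lecR. Qed.

Lemma modulus_ge0 z : 0 <= modulus z.
Proof.
by move: z; case: k => /= z //; case: z => a b /=; rewrite sqrtr_ge0.
Qed.

Lemma modulus_eq0 z : (modulus z == 0) = (z == 0).
Proof.
rewrite -sqrf_eq0 -(fmorph_eq0 ofR) -mulF_conj mulf_eq0.
by rewrite fmorph_eq0 orbb.
Qed.

(** Serves to rotate an eigenvector until its first entry is real and nonpositive. For nonzero [z]
    the factor is [- conj z / |z|]. *)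
Lemma exists_phase z :
  exists2 e : F, e * conj e = 1 & e * z = - ofR (modulus z).
Proof.
have [->|z0] := eqVneq z 0.
  exists 1; first by rewrite rmorph1 mulr1.
  have /eqP-> : modulus (0 : F) == 0 by rewrite modulus_eq0.
  by rewrite rmorph0 mulr0 oppr0.
have m0 : ofR (modulus z) != 0 by rewrite fmorph_eq0 modulus_eq0.
exists (- (conj z / ofR (modulus z))).
  rewrite rmorphN mulrNN rmorphM fmorphV conjFK conjF_ofR mulrACA -invfM.
  rewrite -expr2 -rmorphXn mulrC [conj z * z]mulrC mulF_conj mulVf //.
  by rewrite rmorphXn expf_neq0.
by rewrite mulNr mulrAC [conj z * z]mulrC mulF_conj rmorphXn expr2 mulfK.
Qed.

End ScalarTheory.

(** * Adjoints, squared norms and realness of Hermitian eigenvalues *)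

Lemma mulmx_cV_inj (K : pzRingType) m n (M N : 'M[K]_(m, n)) :
  (forall x : 'cV_n, M *m x = N *m x) -> M = N.
Proof.
move=> MN; apply/matrixP=> i j.
by have /matrixP/(_ i 0) := MN (delta_mx j 0); rewrite -!colE !mxE.
Qed.

Section CtrmxTheory.
Variables (R : realType) (k : scalar_kind).
Local Notation F := (scalars R k).
Local Notation conj := (conjF R k).
Local Notation ofR := (ofR R k).

Lemma ctrmxE m n (M : 'M[F]_(m, n)) i j : ctrmx M i j = conj (M j i).
Proof. by rewrite !mxE. Qed.

Lemma ctrmxK m n (M : 'M[F]_(m, n)) : ctrmx (ctrmx M) = M.
Proof. by apply/matrixP=> i j; rewrite !ctrmxE conjFK. Qed.

Lemma ctrmx_mul m n p (M : 'M[F]_(m, n)) (N : 'M[F]_(n, p)) :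
  ctrmx (M *m N) = ctrmx N *m ctrmx M.
Proof. by rewrite /ctrmx trmx_mul map_mxM. Qed.

Lemma ctrmxD m n (M N : 'M[F]_(m, n)) : ctrmx (M + N) = ctrmx M + ctrmx N.
Proof. by rewrite /ctrmx !raddfD. Qed.

Lemma ctrmxN m n (M : 'M[F]_(m, n)) : ctrmx (- M) = - ctrmx M.
Proof. by rewrite /ctrmx !raddfN. Qed.

Lemma ctrmxZ m n a (M : 'M[F]_(m, n)) : ctrmx (a *: M) = conj a *: ctrmx M.
Proof. by rewrite /ctrmx linearZ map_mxZ. Qed.

Lemma ctrmx0 m n : ctrmx (0 : 'M[F]_(m, n)) = 0.
Proof. by rewrite /ctrmx trmx0 map_mx0. Qed.

Lemma ctrmx_scalar n a : ctrmx (a%:M : 'M[F]_n) = (conj a)%:M.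
Proof. by rewrite /ctrmx tr_scalar_mx map_scalar_mx. Qed.

Lemma ctrmx_row_mx m n p (M : 'M[F]_(m, n)) (N : 'M[F]_(m, p)) :
  ctrmx (row_mx M N) = col_mx (ctrmx M) (ctrmx N).
Proof. by rewrite /ctrmx tr_row_mx map_col_mx. Qed.

Lemma ctrmx_eq0 m n (M : 'M[F]_(m, n)) : ctrmx M = 0 -> M = 0.
Proof. by move=> M0; rewrite -[M]ctrmxK M0 ctrmx0. Qed.

Lemma ctrmx_diag_ofR n (d : 'rV[R]_n) :
  ctrmx (diag_mx (map_mx ofR d)) = diag_mx (map_mx ofR d).
Proof.
apply/matrixP=> i j; rewrite ctrmxE !mxE eq_sym rmorphMn /= conjF_ofR.
by case: eqP => // ->.
Qed.

(** The quantity under the root in [norm2]; as the root is monotone, both have the same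
    minimizers. *)
Definition sqnorm n (x : 'cV[F]_n) : R := \sum_(i < n) modulus (x i 0) ^+ 2.

Lemma sqnormE n (x : 'cV[F]_n) : ctrmx x *m x = (ofR (sqnorm x))%:M.
Proof.
apply/matrixP=> i j; rewrite !ord1 !mxE mulr1n rmorph_sum.
by apply: eq_bigr => l _; rewrite ctrmxE mulrC mulF_conj.
Qed.

Lemma sqnorm_ge0 n (x : 'cV[F]_n) : 0 <= sqnorm x.
Proof. by apply: sumr_ge0 => i _; rewrite exprn_ge0 // modulus_ge0. Qed.

Lemma sqnorm_eq0 n (x : 'cV[F]_n) : sqnorm x = 0 -> x = 0.
Proof.
move=> /eqP; rewrite psumr_eq0 => [/allP x0|i _]; last first.
  by rewrite exprn_ge0 // modulus_ge0.
apply/matrixP=> i j; rewrite ord1 mxE; apply/eqP.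
by rewrite -modulus_eq0 -sqrf_eq0; apply: x0; rewrite mem_index_enum.
Qed.

Lemma sqnorm0 n : sqnorm (0 : 'cV[F]_n) = 0.
Proof.
rewrite /sqnorm big1 // => i _; apply/eqP.
by rewrite sqrf_eq0 modulus_eq0 mxE.
Qed.

Lemma ctrmx_mul_eq0 n p (M : 'M[F]_(n, p)) : ctrmx M *m M = 0 -> M = 0.
Proof.
move=> MM0; apply/matrixP=> i j.
have /sqnorm_eq0/matrixP/(_ i 0) : sqnorm (col j M) = 0; last by rewrite !mxE.
apply: (fmorph_inj ofR); rewrite rmorph0.
move/matrixP/(_ j j): MM0; rewrite mxE [RHS]mxE => <-.
rewrite rmorph_sum; apply: eq_bigr => l _.
by rewrite ctrmxE mulrC mulF_conj !mxE.
Qed.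

Lemma sqnormD_orth n (x y : 'cV[F]_n) :
  ctrmx x *m y = 0 -> sqnorm (x + y) = sqnorm x + sqnorm y.
Proof.
move=> xy0; apply: (fmorph_inj ofR).
have /matrixP/(_ 0 0) : (ofR (sqnorm (x + y)))%:M
    = (ofR (sqnorm x + sqnorm y))%:M :> 'M[F]_1; last by rewrite !mxE.
have yx0 : ctrmx y *m x = 0 by apply: ctrmx_eq0; rewrite ctrmx_mul ctrmxK.
rewrite rmorphD raddfD /= -!sqnormE ctrmxD mulmxDl !mulmxDr xy0 yx0.
by rewrite addr0 add0r.
Qed.

Lemma norm2_le n (x y : 'cV[F]_n) :
  (norm2 x <= norm2 y) = (sqnorm x <= sqnorm y).
Proof. by rewrite /norm2 ler_sqrt ?sqnorm_ge0. Qed.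

(** For a row eigenvector [u], the scalar [u A u^*] equals both [a u u^*] and, by symmetry of [A],
    [conj a u u^*], while [u u^*] is nonzero. *)
Lemma eigenvalue_herm_real n (A : 'M[F]_n) a :
  ctrmx A = A -> eigenvalue A a -> conj a = a.
Proof.
move=> hA /eigenvalueP[u uA u0].
have uu0 : u *m ctrmx u != 0.
  apply: contra_neq u0 => uu; apply: ctrmx_eq0; apply: ctrmx_mul_eq0.
  by rewrite ctrmxK.
have /eqP : conj a *: (u *m ctrmx u) = a *: (u *m ctrmx u).
  rewrite [RHS]scalemxAl -uA -mulmxA -[in RHS]hA -ctrmx_mul uA ctrmxZ.
  by rewrite scalemxAr.
by rewrite -subr_eq0 -scalerBl scaler_eq0 (negPf uu0) orbF subr_eq0 => /eqP.
Qed.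

End CtrmxTheory.

(** * Spectral theorem for Hermitian matrices *)

Lemma exists_real_eigenvalue (R : realType) k n (A : 'M[scalars R k]_n) :
  (0 < n)%N -> ctrmx A = A -> exists r : R, eigenvalue A (ofR R k r).
Proof.
move=> n0; move: A; case: k => A hA.
(* A real symmetric matrix is complexified to obtain an eigenvalue; it is real because [C] is
   Hermitian, and so is already an eigenvalue of [A]. *)
- pose C := (map_mx (real_complex R) A : 'M[scalars R ComplexScalars]_n).
  have hC : ctrmx C = C.
    apply/matrixP=> i j; rewrite ctrmxE !mxE.
    rewrite (conjF_ofR ComplexScalars).
    by have -> : A i j = A j i by rewrite -[in LHS]hA ctrmxE.
  have [a Ca] := @eigenvalue_closed _ n C n0.
  have [r ar] := conjF_real (eigenvalue_herm_real hC Ca).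
  by exists r; move: Ca; rewrite ar (eigenvalue_map (real_complex R)).
- have [a Aa] := @eigenvalue_closed _ n A n0.
  have [r ar] := conjF_real (eigenvalue_herm_real hA Aa).
  by exists r; rewrite -ar.
Qed.

Section Spectral.
Variables (R : realType) (k : scalar_kind).
Local Notation F := (scalars R k).
Local Notation conj := (conjF R k).
Local Notation ofR := (ofR R k).

(* The reflection exchanging e_0 and w; it needs ctrmx w *m e_0 to be real, and
   the sign of w 0 0 ensures w != e_0. *)
Lemma householder n (w : 'cV[F]_n.+1) (m : R) :
  ctrmx w *m w = 1%:M -> w 0 0 = - ofR m -> 0 <= m ->
  exists2 H : 'M[F]_n.+1, ctrmx H *m H = 1%:M & H *m delta_mx 0 0 = w.
Proof.
move=> ww w0 m0.
pose e : 'cV[F]_n.+1 := delta_mx 0 0; pose u := w - e.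
have we : ctrmx w *m e = (- ofR m)%:M.
  apply/matrixP=> i j; rewrite !ord1 -colE !mxE w0 rmorphN conjF_ofR.
  by rewrite mulr1n.
have ee : ctrmx e *m e = 1%:M.
  by apply/matrixP=> i j; rewrite !ord1 -colE !mxE eqxx rmorph1.
have ew : ctrmx e *m w = (- ofR m)%:M.
  by rewrite -[LHS]ctrmxK ctrmx_mul ctrmxK we ctrmx_scalar rmorphN conjF_ofR.
have ue : ctrmx u *m e = (- ofR (m + 1))%:M.
  by rewrite ctrmxD ctrmxN mulmxDl mulNmx we ee -raddfB -opprD rmorphD rmorph1.
have uu : ctrmx u *m u = (ofR (2 * (m + 1)))%:M.
  rewrite {2}/u mulmxBr ue ctrmxD ctrmxN mulmxDl mulNmx ww ew -!raddfB /=.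
  rewrite mulr_natl mulr2n !rmorphD rmorph1 /=.
  by rewrite !opprK [1%:M + _]addrC raddfD.
have eu : e + u = w by rewrite addrC subrK.
move: u eu ue uu => u eu ue uu.
have m1 : ofR (m + 1) != 0 by rewrite fmorph_eq0 gt_eqF // ltr_wpDl.
(* As [u^* u = 2 (m + 1)], this [H] is the reflection [I - 2 u u^* / (u^* u)]. *)
pose c := (ofR (m + 1))^-1; pose H := 1%:M - c *: (u *m ctrmx u).
have hH : ctrmx H = H.
  rewrite /H ctrmxD ctrmxN ctrmxZ ctrmx_mul ctrmxK ctrmx_scalar rmorph1.
  by rewrite fmorphV conjF_ofR.
exists H.
  rewrite hH /H mulmxBr mulmx1 mulmxBl mul1mx -scalemxAl -scalemxAr.
  rewrite mulmxA -[u *m _ *m u]mulmxA uu mul_mx_scalar -scalemxAl !scalerA.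
  rewrite rmorphM rmorph_nat mulrA mulrA [_ * 2]mulrC -!mulrA mulVf //.
  by rewrite mulr1 -scalerA scaler_nat mulr2n opprB addrK subrK.
rewrite /H mulmxBl mul1mx -scalemxAl -mulmxA ue mul_mx_scalar scalerA.
by rewrite mulrN mulVf // scaleN1r opprK.
Qed.

Lemma herm_unit_eigenvector n (A : 'M[F]_n.+1) :
  ctrmx A = A -> exists (w : 'cV[F]_n.+1) (r m : R),
    [/\ A *m w = ofR r *: w, ctrmx w *m w = 1%:M, w 0 0 = - ofR m & 0 <= m].
Proof.
move=> hA.
have [r /eigenvalueP[x xA x0]] := exists_real_eigenvalue (ltn0Sn n) hA.
(* Eigenvectors in the sense of [eigenvalue] are rows; since [A] is Hermitian and [r] real, the
   adjoint is a column eigenvector. *)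
pose v := ctrmx x.
have Av : A *m v = ofR r *: v.
  by rewrite -{1}hA -ctrmx_mul xA ctrmxZ conjF_ofR.
have v0 : v != 0 by apply: contra_neq x0 => /ctrmx_eq0.
pose s := Num.sqrt (sqnorm v).
have s0 : s != 0.
  rewrite sqrtr_eq0 -ltNge lt_def sqnorm_ge0 andbT.
  by apply: contra_neq v0 => /sqnorm_eq0.
have [e ee ev] := exists_phase (v 0 0).
exists ((e / ofR s) *: v), r, (modulus (v 0 0) / s); split.
- by rewrite -scalemxAr Av !scalerA mulrC.
- rewrite ctrmxZ -scalemxAl -scalemxAr scalerA sqnormE.
  rewrite -(sqr_sqrtr (sqnorm_ge0 v)) -mul_scalar_mx -scalar_mxM.
  rewrite rmorphM fmorphV conjF_ofR mulrACA [conj e * e]mulrC ee mul1r -invfM -expr2 rmorphXn mulVf //.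
  by rewrite expf_neq0 // fmorph_eq0.
- by rewrite mxE mulrAC ev mulNr rmorphM fmorphV.
- by rewrite divr_ge0 ?modulus_ge0 ?sqrtr_ge0.
Qed.

(** Induction by deflation: a unitary [H] sending [e_0] to a unit eigenvector makes [H^* A H] block
    diagonal, and the induction hypothesis diagonalizes the lower block. *)
Lemma herm_spectral n (A : 'M[F]_n) : ctrmx A = A ->
  exists (U : 'M[F]_n) (d : 'rV[R]_n),
    ctrmx U *m U = 1%:M /\ A = U *m diag_mx (map_mx ofR d) *m ctrmx U.
Proof.
elim: n A => [|n IHn] A hA.
  by exists 1%:M, 0; split; apply/matrixP=> -[].
have [w [r [m [Aw ww w0 m0]]]] := herm_unit_eigenvector hA.
have [H HH He] := householder ww w0 m0.
have HH' : H *m ctrmx H = 1%:M by apply: mulmx1C.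
have [C defC] : {C : 'M[F]_(1 + n) | C = ctrmx H *m A *m H} by eexists.
have hC : ctrmx C = C by rewrite defC !ctrmx_mul ctrmxK hA mulmxA.
have Ce : ctrmx H *m A *m H *m delta_mx 0 0 = ofR r *: delta_mx 0 0 :> 'cV_n.+1.
  by rewrite -mulmxA He -mulmxA Aw -scalemxAr -He mulmxA HH mul1mx.
have C0 i : C i (lshift n 0) = ofR r *+ (i == lshift n 0).
  by have /matrixP/(_ i 0) := Ce; rewrite -defC -colE lshift0 mxE => ->;
    rewrite !mxE andbT mulr_natr.
pose D := drsubmx C.
have hD : ctrmx D = D.
  by rewrite /D -[in RHS]hC; apply/matrixP=> i j; rewrite !mxE.
(* The first column of [C] is known from the eigenvector, the first row by Hermitian symmetry. *)
have CE : C = block_mx (ofR r)%:M 0 0 D.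
  rewrite -[LHS]submxK; congr block_mx; apply/matrixP=> i j; rewrite !ord1 !mxE.
  - by rewrite C0 !eqxx.
  - by rewrite -[in LHS]hC ctrmxE C0 eq_rlshift rmorph0.
  - by rewrite C0 eq_rlshift.
have [U' [d' [UU' DE]]] := IHn D hD.
pose Q : 'M[F]_(1 + n) := block_mx 1%:M 0 0 U'.
have cQ : ctrmx Q = block_mx 1%:M 0 0 (ctrmx U').
  rewrite /ctrmx tr_block_mx map_block_mx !trmx0 !map_mx0 tr_scalar_mx.
  by rewrite map_mx1.
have QQ : ctrmx Q *m Q = 1%:M.
  rewrite cQ mulmx_block !mul0mx !mulmx0 !add0r !addr0 UU' mul1mx.
  by rewrite -scalar_mx_block.
exists (H *m Q), (row_mx r%:M d'); split.
  by rewrite ctrmx_mul mulmxA -[_ *m _ *m H]mulmxA HH mulmx1.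
have dE : diag_mx (map_mx ofR (row_mx r%:M d')) =
    block_mx (ofR r)%:M 0 0 (diag_mx (map_mx ofR d')) :> 'M[F]_(1 + n).
  rewrite map_row_mx diag_mx_row map_scalar_mx; congr block_mx.
  by apply/matrixP=> i j; rewrite !ord1 !mxE eqxx !mulr1n.
have QC : Q *m diag_mx (map_mx ofR (row_mx r%:M d')) *m ctrmx Q = C.
  rewrite cQ dE CE !mulmx_block !mul0mx !mulmx0 !add0r !addr0.
  by rewrite ?(mul1mx, mulmx1, mul0mx, mulmx0, addr0, add0r) -DE.
rewrite ctrmx_mul mulmxA -[H *m Q *m _]mulmxA -[_ *m ctrmx Q]mulmxA QC defC.
by rewrite !mulmxA HH' mul1mx -mulmxA HH' mulmx1.
Qed.

End Spectral.

(** * The weighted least-squares problem: characterization and existence of its minimizer *)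

Section ShiftedMinimizer.
Variables (R : realType) (k : scalar_kind).
Local Notation F := (scalars R k).
Local Notation ofR := (ofR R k).

(** A nonzero entry [i] of [v U], for a row eigenvector [v], forces the eigenvalue to be [d_i];
    conversely row [i] of [U^*] is an eigenvector for [d_i]. *)
Lemma eigenvalue_spectral n (A U : 'M[F]_n) (d : 'rV[R]_n) m :
  ctrmx U *m U = 1%:M -> A = U *m diag_mx (map_mx ofR d) *m ctrmx U ->
  eigenvalue A m <-> exists i, m = ofR (d 0 i).
Proof.
move=> UU AE; have UU' := mulmx1C UU.
have cUA : ctrmx U *m A = diag_mx (map_mx ofR d) *m ctrmx U.
  by rewrite AE !mulmxA UU mul1mx.
split=> [/eigenvalueP[v vA v0]|[i ->]].
  pose u := v *m U.
  have ud : u *m diag_mx (map_mx ofR d) = m *: u.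
    by rewrite /u scalemxAl -vA AE -!mulmxA UU mulmx1.
  have /rV0Pn[i ui] : u != 0.
    by apply: contra_neq v0 => u0; rewrite -[v]mulmx1 -UU' mulmxA -/u u0 mul0mx.
  move: u ud ui => u ud ui.
  exists i; apply: (mulfI ui); have /matrixP/(_ 0 i) := ud.
  by rewrite mul_mx_diag !mxE [m * _]mulrC => ->.
apply/eigenvalueP; exists (row i (ctrmx U)).
  by rewrite -row_mul cUA row_mul row_diag_mx mxE -scalemxAl -rowE.
apply/eqP=> r0; have /eqP := oner_neq0 F; case.
have /matrixP/(_ i i) := UU; rewrite [RHS]mxE eqxx mulr1n => <-.
rewrite mxE big1 // => j _; have /rowP/(_ j) := r0.
by rewrite !mxE => ->; rewrite mul0r.
Qed.

Lemma lambda_min_le n (A U : 'M[F]_n) (d : 'rV[R]_n) i :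
  ctrmx U *m U = 1%:M -> A = U *m diag_mx (map_mx ofR d) *m ctrmx U ->
  lambda_min A <= d 0 i.
Proof.
move=> UU AE; have eigA m := eigenvalue_spectral m UU AE.
have [_ lmin] : [set l : R | eigenvalue A (ofR l) /\
    forall m : F, eigenvalue A m -> ofR l <= m]%classic (lambda_min A).
  apply: xgetPex.
  (* The index [i] shows that there is at least one eigenvalue, so a least one exists and [xget]
     does not return its default. *)
  have [j _ jmin] := @Order.TotalTheory.arg_minP _ _ _ i xpredT (d 0) isT.
  exists (d 0 j); split; first by apply/eigA; exists j.
  by move=> m /eigA[l ->]; rewrite ler_ofR jmin.
by rewrite -(ler_ofR k); apply: lmin; apply/eigA; exists i.
Qed.

(** The minimization uses the inverse square root [W] only through this identity, which makes
    [W^* W] the inverse of [M]. *)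
Lemma invsqrtmx_shift n (A : 'M[F]_n) (omega : R) :
  ctrmx A = A -> - lambda_min A < omega ->
  let M := A + (ofR omega)%:M in let W := invsqrtmx M in
  M *m (ctrmx W *m W) = 1%:M.
Proof.
move=> hA om M W; have [U [d [UU AE]]] := herm_spectral hA.
have [U1 [d1 [UU1 d1_gt0 ME WE]]] :
    [set N | exists (U : 'M[F]_n) (d : 'rV[R]_n),
    [/\ ctrmx U *m U = 1%:M,
        forall i, 0 < d 0 i,
        M = U *m diag_mx (map_mx ofR d) *m ctrmx U &
        N = U *m diag_mx (map_mx (fun t => ofR (Num.sqrt t)^-1) d)
              *m ctrmx U]]%classic W.
  apply: xgetPex.
  (* Shifting the spectral decomposition of [A] by [omega] gives positive eigenvalues, as [omega]
     exceeds [- lambda_min A]. *)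
  exists (U *m diag_mx (map_mx (fun t => ofR (Num.sqrt t)^-1)
     (d + const_mx omega)) *m ctrmx U), U, (d + const_mx omega).
  split=> // [i|].
    rewrite !mxE -ltrBlDr sub0r (lt_le_trans _ (lambda_min_le i UU AE)) //.
    by rewrite ltrNl.
  rewrite map_mxD map_const_mx raddfD mulmxDr mulmxDl -AE; congr (_ + _).
  by rewrite /= diag_const_mx mul_mx_scalar -scalemxAl (mulmx1C UU) scalemx1.
(* The diagonal is rewritten with embedded real entries, so that it is its own adjoint. *)
have WE' : W = U1 *m diag_mx (map_mx ofR (map_mx (fun t => (Num.sqrt t)^-1) d1))
    *m ctrmx U1.
  by rewrite WE -map_mx_comp.
rewrite {}WE' !ctrmx_mul ctrmxK ctrmx_diag_ofR {}ME.
rewrite !mulmxA -[_ *m ctrmx U1 *m U1]mulmxA UU1 mulmx1.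
rewrite -[_ *m ctrmx U1 *m U1]mulmxA UU1 mulmx1.
rewrite -[U1 *m _ *m _]mulmxA mulmx_diag -[U1 *m _ *m _]mulmxA mulmx_diag.
set E := diag_mx _; suff -> : E = 1%:M by rewrite mulmx1 (mulmx1C UU1).
rewrite /E -diag_const_mx; congr diag_mx.
apply/rowP=> i; rewrite !mxE -!rmorphM -mulrA -invfM -expr2.
by rewrite sqr_sqrtr ?ltW // mulfV ?rmorph1 // gt_eqF.
Qed.

Lemma memv_colspace m p (V : 'M[F]_(m, p)) x :
  reflect (exists y, x = V *m y) (x \in colspace V).
Proof.
apply: (iffP memv_imgP) => [[y _ ->]|[y ->]]; exists y => //.
- by rewrite lfunE.
- by rewrite memvf.
- by rewrite lfunE.
Qed.

Lemma colspace_orth n p m (A : 'M[F]_n) (V : 'M[F]_(n, p)) (s : 'M[F]_(n, m)) :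
  ctrmx V *m A *m s = 0 ->
  forall y, y \in colspace V -> ctrmx y *m A *m s = 0.
Proof.
move=> sP _ /memv_colspace[z ->].
by rewrite ctrmx_mul -!mulmxA [ctrmx V *m _]mulmxA sP mulmx0.
Qed.

(** The residual at [x] is [M s], and [W M s] is orthogonal to [W A S] because [W^* W M = I] and [s]
    is orthogonal to [A S]. Pythagoras then makes [x] a minimizer. *)
Lemma argmin_sol_eq n (A : 'M[F]_n) (S : {vspace 'cV[F]_n}) b omega x s :
  ctrmx A = A -> A \in unitmx -> - lambda_min A < omega ->
  x \in S -> (forall y, y \in S -> ctrmx y *m A *m s = 0) ->
  b = A *m x + (A + (ofR omega)%:M) *m s ->
  argmin_sol A S b omega = x.
Proof.
move=> hA uA om xS sP bE; rewrite /argmin_sol.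
set M := A + _; set W := invsqrtmx M.
have MWW : M *m (ctrmx W *m W) = 1%:M by apply: invsqrtmx_shift.
have WWM := mulmx1C MWW.
have pyth y : y \in S -> sqnorm (W *m (b - A *m y)) =
    sqnorm (W *m A *m (x - y)) + sqnorm (W *m M *m s).
  move=> yS; have -> : W *m (b - A *m y) = W *m A *m (x - y) + W *m M *m s.
    by rewrite -!mulmxA -mulmxDr bE [A *m (x - y)]mulmxBr addrAC.
  apply: sqnormD_orth; rewrite !ctrmx_mul hA -!mulmxA.
  rewrite [ctrmx W *m _]mulmxA [ctrmx W *m W *m _]mulmxA WWM mul1mx mulmxA.
  by apply: sP; rewrite rpredB.
have minx : x \in S /\ forall y, y \in S ->
    norm2 (W *m (b - A *m x)) <= norm2 (W *m (b - A *m y)).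
  split=> // y yS; rewrite norm2_le !pyth // subrr mulmx0 sqnorm0 lerD2r.
  exact: sqnorm_ge0.
(* Uniqueness: a second minimizer [y] satisfies [W A (x - y) = 0], and [W A] is injective. *)
apply: xget_unique => // y [yS miny].
have := miny x xS; rewrite norm2_le !pyth // subrr mulmx0 sqnorm0 lerD2r.
move=> le0; have /eqP : sqnorm (W *m A *m (x - y)) == 0.
  by rewrite eq_le le0 sqnorm_ge0.
move/sqnorm_eq0/(congr1 (mulmx (M *m ctrmx W))).
rewrite !mulmxA -[M *m _ *m W]mulmxA MWW mul1mx mulmx0.
by move/(congr1 (mulmx (invmx A))); rewrite mulKmx // mulmx0 => /subr0_eq.
Qed.

(** Existence comes from solving the normal equations [G^* G y = G^* W b] with [G = W A V]; then [s]
    is [M^-1] applied to the residual. *)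
Lemma argmin_sol_colspace n p (A : 'M[F]_n) (V : 'M[F]_(n, p)) b omega :
  ctrmx A = A -> A \in unitmx -> ctrmx V *m V = 1%:M ->
  - lambda_min A < omega ->
  exists y s, [/\ argmin_sol A (colspace V) b omega = V *m y,
    ctrmx V *m A *m s = 0 & b = A *m (V *m y) + (A + (ofR omega)%:M) *m s].
Proof.
move=> hA uA VV om; set M := A + _; pose W := invsqrtmx M.
have MWW : M *m (ctrmx W *m W) = 1%:M by apply: invsqrtmx_shift.
pose G := W *m A *m V.
have uG : ctrmx G *m G \in unitmx.
  rewrite -row_free_unit; apply: inj_row_free => v vGG.
  have Gv : G *m ctrmx v = 0.
    apply: ctrmx_mul_eq0; rewrite ctrmx_mul ctrmxK.
    by rewrite mulmxA -[v *m _ *m _]mulmxA vGG mul0mx.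
  apply: ctrmx_eq0.
  (* [V^* A^-1 M W^*] is a left inverse of [G]. *)
  have -> : ctrmx v = ctrmx V *m invmx A *m (M *m ctrmx W) *m (G *m ctrmx v).
    rewrite /G -!mulmxA [ctrmx W *m (W *m _)]mulmxA [M *m (_ *m _)]mulmxA MWW.
    by rewrite mul1mx mulKmx // mulmxA VV mul1mx.
  by rewrite Gv mulmx0.
pose y := invmx (ctrmx G *m G) *m (ctrmx G *m W *m b).
pose s := ctrmx W *m W *m (b - A *m (V *m y)).
have sP : ctrmx V *m A *m s = 0.
  have -> : ctrmx V *m A *m s = ctrmx G *m W *m (b - A *m (V *m y)).
    by rewrite /s /G !ctrmx_mul hA !mulmxA.
  rewrite mulmxBr.
  have <- : ctrmx G *m G *m y = ctrmx G *m W *m (A *m (V *m y)).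
    by rewrite {2}/G !mulmxA.
  by rewrite /y mulKVmx // subrr.
have bE : b = A *m (V *m y) + M *m s.
  by rewrite /s [M *m _]mulmxA MWW mul1mx addrC subrK.
exists y, s; split=> //; apply: argmin_sol_eq bE => //.
  by apply/memv_colspace; exists y.
exact: colspace_orth.
Qed.

End ShiftedMinimizer.

(** * The space of differences in the coordinates of [V], and its dimension *)

Section DifferenceSpace.
Variables (R : realType) (k : scalar_kind) (n p q : nat).
Local Notation F := (scalars R k).
Local Notation ofR := (ofR R k).
Variables (A : 'M[F]_n) (V : 'M[F]_(n, p)) (V' : 'M[F]_(n, q)).
Variables (T : 'M[F]_p) (B : 'M[F]_(q, p)).
Hypothesis hA : ctrmx A = A.
Hypothesis uA : A \in unitmx.
Hypothesis VV : ctrmx V *m V = 1%:M.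
Hypothesis VV' : ctrmx V *m V' = 0.
Hypothesis TE : T = ctrmx V *m A *m V.
Hypothesis BE : B = ctrmx V' *m A *m V.
Hypothesis AV : A *m V = V *m T + V' *m B.

Let hT : ctrmx T = T.
Proof. by rewrite TE !ctrmx_mul ctrmxK hA mulmxA. Qed.

Let hB : ctrmx B = ctrmx V *m A *m V'.
Proof. by rewrite BE !ctrmx_mul ctrmxK hA mulmxA. Qed.

Lemma compression_inj m (y : 'M[F]_(p, m)) : T *m y = 0 -> B *m y = 0 -> y = 0.
Proof.
move=> Ty By; rewrite -[y]mul1mx -VV -mulmxA -[V *m y](mulKmx uA).
by rewrite [A *m _]mulmxA AV mulmxDl -!mulmxA Ty By !mulmx0 addr0 !mulmx0.
Qed.

(** Since [T] is Hermitian, [T^2 y = 0] gives [(T y)^* T y = 0], hence [T y = 0]. *)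
Lemma compression_sqr_inj m (y : 'M[F]_(p, m)) :
  T *m (T *m y) = 0 -> B *m y = 0 -> y = 0.
Proof.
move=> TTy; apply: compression_inj; apply: ctrmx_mul_eq0.
by rewrite ctrmx_mul hT -mulmxA TTy mulmx0.
Qed.

(** The adjoint of [AV] reads [V^* A = T V^* + B^* V'^*]; it is applied to [s]. *)
Lemma orth_imspaceE (s : 'cV[F]_n) : ctrmx V *m A *m s = 0 ->
  T *m (ctrmx V *m s) = - (ctrmx B *m (ctrmx V' *m s)).
Proof.
have -> : ctrmx V *m A = T *m ctrmx V + ctrmx B *m ctrmx V'.
  by rewrite -{1}hA -ctrmx_mul AV ctrmxD !ctrmx_mul hT.
by rewrite mulmxDl -!mulmxA => /eqP; rewrite addr_eq0 => /eqP.
Qed.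

Lemma argmin_sol_diff b omega mu :
  - lambda_min A < omega -> - lambda_min A < mu ->
  exists y w, argmin_sol A (colspace V) b omega -
    argmin_sol A (colspace V) b mu = V *m y /\ T *m (T *m y) = ctrmx B *m w.
Proof.
move=> om_gt mu_gt.
have [y1 [s1 [-> s1P b1]]] := argmin_sol_colspace b hA uA VV om_gt.
have [y2 [s2 [-> s2P b2]]] := argmin_sol_colspace b hA uA VV mu_gt.
(* Comparing [V^* b] in both representations of [b] gives [T (y1 - y2) = V^* s] for this
   combination. *)
pose s := ofR mu *: s2 - ofR omega *: s1.
have sP : ctrmx V *m A *m s = 0.
  by rewrite mulmxBr -!scalemxAr s1P s2P !scaler0 subrr.
have Vb y om t : ctrmx V *m A *m t = 0 ->
    ctrmx V *m (A *m (V *m y) + (A + (ofR om)%:M) *m t) =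
    T *m y + ofR om *: (ctrmx V *m t).
  move=> tP; rewrite mulmxDl !mulmxDr [ctrmx V *m (A *m t)]mulmxA tP add0r.
  by rewrite TE !mulmxA mul_mx_scalar -scalemxAl.
exists (y1 - y2), (- (ctrmx V' *m s)); split; first by rewrite mulmxBr.
have -> : T *m (y1 - y2) = ctrmx V *m s.
  have := congr1 (mulmx (ctrmx V)) b1; rewrite {1}b2 !Vb //.
  move=> /esym/(canRL (addrK _)) Ty.
  by rewrite /s !mulmxBr -!scalemxAr Ty [LHS]addrC -addrA addKr.
by rewrite orth_imspaceE // mulmxN.
Qed.

Lemma mem_diffspace (y : 'cV[F]_p) w : T *m (T *m y) = ctrmx B *m w ->
  V *m y \in diffspace A (colspace V).
Proof.
move=> TTy; apply: (setspanP _).1.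
(* Two admissible shifts at distance 1, so that [A + mu I] is [A + om I] plus the identity. *)
pose om : R := 1 - lambda_min A; pose mu : R := 2 - lambda_min A.
have om_gt : - lambda_min A < om by rewrite ltrDr ltr01.
have mu_gt : - lambda_min A < mu by rewrite ltrDr ltr0n.
have mu_om : ofR mu = ofR om + 1.
  by rewrite -[1](rmorph1 ofR) -rmorphD /mu /om addrAC.
(* Chosen so that [A s' = - V' (w + B y)]: this is orthogonal to [V], and it replaces the part
   [V' B y] of [A V y] by [- V' w]. *)
pose s' := - (invmx A *m (V' *m (w + B *m y))).
have s'P : ctrmx V *m A *m s' = 0.
  by rewrite /s' mulmxN -mulmxA mulKVmx // mulmxA VV' mul0mx oppr0.
pose t := A *m (V *m y) + (A + (ofR om)%:M) *m s'.
have tE : t = V *m (T *m y) - V' *m w + ofR om *: s'.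
  rewrite /t mulmxDl mul_scalar_mx addrA; congr (_ + _).
  rewrite /s' mulmxN mulKVmx // mulmxA AV mulmxDl -!mulmxA mulmxDr opprD addrA.
  by rewrite addrAC addrK.
have tP : ctrmx V *m A *m t = 0.
  rewrite tE mulmxDr mulmxBr -scalemxAr s'P scaler0 addr0 !mulmxA.
  by rewrite -TE -hB -mulmxA TTy subrr.
exists ((A + (ofR mu)%:M) *m t), om, mu; split=> //.
rewrite (argmin_sol_eq (x := V *m y) (s := t + s')) //; first last.
- rewrite [in RHS]mulmxDr addrCA -/t !mulmxDl !mul_scalar_mx mu_om scalerDl.
  by rewrite scale1r addrA.
- by apply: colspace_orth; rewrite mulmxDr tP s'P addr0.
- by apply/memv_colspace; exists y.
rewrite (argmin_sol_eq (x := 0) (s := t)) ?subr0 ?mem0v ?mulmx0 ?add0r //.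
exact: colspace_orth.
Qed.

(** The differences are the image under [f : (y, w) |-> V y] of the kernel of
    [h : (y, w) |-> T^2 y - B^* w]. As [f] is injective on that kernel and [h] is onto, rank-nullity
    gives [(p + q) - p]. *)
Lemma dim_diffspace_colspace :
  (forall u : 'rV[F]_q, u *m B = 0 -> u = 0) ->
  \dim (diffspace A (colspace V)) = q.
Proof.
move=> Binj.
pose G := row_mx (T *m T) (- ctrmx B).
pose h := linfun (mulmx G : 'cV_(p + q) -> 'cV_p).
pose f := linfun (mulmx (row_mx V 0) : 'cV_(p + q) -> 'cV_n).
have hE y w : (col_mx y w \in lker h) = (T *m T *m y == ctrmx B *m w).
  by rewrite memv_ker lfunE /= mul_row_col mulNmx subr_eq0.
have fE (y : 'cV_p) (w : 'cV_q) : f (col_mx y w) = V *m y.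
  by rewrite lfunE /= mul_row_col mul0mx addr0.
have -> : diffspace A (colspace V) = (f @: lker h)%VS.
  apply/eqP; rewrite eqEsubv; apply/andP; split.
    apply: (setspanP _).2 => z [b [om [mu [om_gt mu_gt ->]]]].
    have [y [w [-> TTy]]] := argmin_sol_diff b om_gt mu_gt.
    by rewrite -(fE y w) memv_img // hE -mulmxA TTy.
  apply/subvP=> _ /memv_imgP[x + ->]; rewrite -[x]vsubmxK hE fE -mulmxA.
  by move/eqP/mem_diffspace.
have BTinj (w : 'cV_q) : ctrmx B *m w = 0 -> w = 0.
  move=> Bw; apply: ctrmx_eq0; apply: Binj.
  by apply: ctrmx_eq0; rewrite ctrmx_mul ctrmxK.
(* Injectivity of [f] on the kernel: [V y = 0] gives [y = 0], then [B^* w = 0] gives [w = 0]. *)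
rewrite limg_dim_eq; last first.
  apply/eqP; rewrite -subv0; apply/subvP=> x; rewrite memv_cap -[x]vsubmxK hE.
  rewrite memv_ker fE => /andP[/eqP Tx /eqP/(congr1 (mulmx (ctrmx V)))].
  rewrite mulmxA VV mul1mx mulmx0 => x0; move: Tx.
  by rewrite x0 mulmx0 => /esym/BTinj ->; rewrite col_mx0 mem0v.
(* A right inverse [K] of [G] will show that [h] is onto. *)
have /row_freeP[K GK] : row_free G.
  apply: inj_row_free => v; rewrite mul_mx_row => /eqP; rewrite -row_mx0.
  move=> /eqP/eq_row_mx[vT]; rewrite mulmxN => /eqP.
  rewrite oppr_eq0 => /eqP vB.
  apply: ctrmx_eq0; apply: compression_sqr_inj.
    by rewrite -hT -!ctrmx_mul -mulmxA vT ctrmx0.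
  by rewrite -[B]ctrmxK -ctrmx_mul vB ctrmx0.
have hfull : limg h = fullv.
  apply/eqP; rewrite eqEsubv subvf; apply/subvP=> z _.
  apply/memv_imgP; exists (K *m z); rewrite ?memvf // lfunE /= mulmxA GK.
  by rewrite mul1mx.
have := limg_ker_dim h fullv; rewrite hfull capfv !dimvf /dim /= !muln1.
by rewrite [RHS]addnC => /addIn.
Qed.

End DifferenceSpace.

(** * The dimension formula, from the given orthonormal bases *)

Theorem corollary4p13 (R : realType) (k : scalar_kind) (n p q : nat)
  (A : 'M[scalars R k]_n) (S : {vspace 'cV[scalars R k]_n})
  (V : 'M[scalars R k]_(n, p)) (V' : 'M[scalars R k]_(n, q))
  (A_herm : A \is hermitianmx n false (conjF R k))
  (A_inv : A \in unitmx)
  (dimS : \dim S = p) (p_bounds : (1 <= p <= n)%N)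
  (q_def : q = Ind A S) (q_ge1 : (1 <= q)%N)
  (VV'_orth : ctrmx (row_mx V V') *m row_mx V V' = 1%:M)
  (V_im : colspace V = S)
  (VV'_im : colspace (row_mx V V') = (S + imspace A S)%VS) :
  let T : 'M[scalars R k]_p := ctrmx V *m A *m V in
  let B : 'M[scalars R k]_(q, p) := ctrmx V' *m A *m V in
  (colspace T :&: colspace (ctrmx B))%VS = 0%VS \/ T \in unitmx ->
  \dim (diffspace A S) = Ind A S.
Proof.
move=> T B _; rewrite -q_def -V_im.
have hA : ctrmx A = A.
  by move/is_hermitianmxP: A_herm => {2}->; rewrite expr0 scale1r.
move: (VV'_orth); rewrite ctrmx_row_mx mul_col_row scalar_mx_block.
move=> /eq_block_mx[VV VV' V'V V'V'].
have AV : A *m V = V *m T + V' *m B.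
  (* [V V^* + V' V'^*] is the orthogonal projection onto [S + A S], so it fixes the columns of
     [A V]. *)
  have -> : V *m T + V' *m B = row_mx V V' *m ctrmx (row_mx V V') *m (A *m V).
    by rewrite ctrmx_row_mx mul_row_col mulmxDl /T /B !mulmxA.
  apply: mulmx_cV_inj => y.
  have /memv_colspace[z AVy] : A *m V *m y \in colspace (row_mx V V').
    rewrite VV'_im (subvP (addvSr _ _)) //; apply/memv_imgP.
    exists (V *m y); last by rewrite lfunE /= mulmxA.
    by rewrite -V_im; apply/memv_colspace; exists y.
  by rewrite -[RHS]mulmxA AVy -mulmxA [_ *m (_ *m z)]mulmxA VV'_orth mul1mx.
apply: (dim_diffspace_colspace hA A_inv VV VV' (erefl T) (erefl B) AV) => u uB.
(* If [u B = 0], the functional [u V'^*] kills [S] since [V'^* V = 0], and [A S] since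
   [V'^* A V = B]. It thus kills the columns of [V'], and [u = u V'^* V' = 0]. *)
have uV'0 x : x \in (S + imspace A S)%VS -> u *m ctrmx V' *m x = 0.
  case/memv_addP=> s + [_ /memv_imgP[t + ->] ->]; rewrite lfunE /= -V_im.
  move=> /memv_colspace[y ->] /memv_colspace[z ->]; rewrite mulmxDr.
  rewrite mulmxA -[u *m _ *m V]mulmxA V'V mulmx0 mul0mx add0r.
  by rewrite !mulmxA -[u *m _ *m A]mulmxA -[u *m _ *m V]mulmxA uB mul0mx.
apply: mulmx_cV_inj => z; rewrite mul0mx -[u]mulmx1 -V'V' mulmxA -[LHS]mulmxA.
apply: uV'0; rewrite -VV'_im; apply/memv_colspace; exists (col_mx 0 z).
by rewrite mul_row_col mulmx0 add0r.
Qed.
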